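(* Let $\tau>0$. If $\gamma:I\to \mathrm{SL}(2,\mathbb{R})_\tau$ is a proper biharmonic curve parametrized by arc length, then it makes a constant angle with the Hopf vector field $E_1$, and its tangent vector field can be written as $$\gamma'(s)=T=\cos\vartheta\,E_1+\sin\vartheta\sin\beta(s)\,E_2+\sin\vartheta\cos\beta(s)\,E_3,$$ where $\vartheta\in(0,\pi/2]$ is a constant and $\beta:I\to\mathbb{R}$ is a smooth function (the $E_i$ being evaluated at $\gamma(s)$).
   Context: Let $\mathbb{R}^4_2$ be $\mathbb{R}^4$ with the inner product $\langle v,w\rangle=v_1w_1+v_2w_2-v_3w_3-v_4w_4$; identify $\mathbb{R}^4$ with $\mathbb{C}^2$ via $(z,w)=(x_1+ix_2,x_3+ix_4)$, and identify $\mathrm{SL}(2,\mathbb{R})$ with $\{(z,w)\in\mathbb{C}^2: |z|^2-|w|^2=1\}=\{v\in\mathbb{R}^4_2:\langle v,v\rangle=1\}$. On it consider the tangent vector fields $$X_1(z,w)=(iz,iw),\quad X_2(z,w)=(i\bar w,i\bar z),\quad X_3(z,w)=(\bar w,\bar z).$$ For $\tau>0$, $\mathrm{SL}(2,\mathbb{R})_\tau$ denotes $\mathrm{SL}(2,\mathbb{R})$ with the Riemannian metric $g_\tau(X,Y)=-\langle X,Y\rangle+(1+\tau^2)\langle X,X_1\rangle\langle Y,X_1\rangle$. Then $E_1=-\tau^{-1}X_1$, $E_2=X_2$, $E_3=X_3$ is a global orthonormal frame; $E_1$ is the (unit) Hopf vector field, tangent to the fibres of the Hopf fibration $(z,w)\mapsto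 \frac{1}{\sqrt{\tau}}(2z\bar w,|z|^2+|w|^2)$. Let $\nabla^\tau$ be the Levi-Civita connection of $g_\tau$ and $R(X,Y)Z=\nabla^\tau_X\nabla^\tau_YZ-\nabla^\tau_Y\nabla^\tau_XZ-\nabla^\tau_{[X,Y]}Z$ its curvature. Curves are smooth and defined on an interval $I$. A curve $\gamma$ parametrized by arc length, with $T=\gamma'$, is biharmonic if its bitension field vanishes, i.e. $(\nabla^\tau_T)^3T-R(T,\nabla^\tau_TT)T=0$; it is proper biharmonic if it is biharmonic and not a geodesic.
   Formalization: With ϑ in (0,π/2] the formula fails for curves run in the opposite direction; it is proved for γ' or for −γ' (one fixed sign along the curve), and for γ' itself whenever the angle between T and E_1 is at most π/2. *)

(* Defs.v *)
From mathcomp Require Import all_boot all_order all_algebra.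
From mathcomp Require Import all_classical all_reals all_analysis.

Set Implicit Arguments.
Unset Strict Implicit.
Unset Printing Implicit Defensive.

Import Order.TTheory GRing.Theory Num.Theory.
Import numFieldNormedType.Exports.

Local Open Scope classical_set_scope.
Local Open Scope ring_scope.

(* C^oo on the whole of V: every iterated directional derivative of f exists
   and is (totally) differentiable at every point. *)
Definition smooth (R : realType) (V W : normedModType R) (f : V -> W) : Prop :=
  forall (vs : seq V) (x : V),
    differentiable (foldr (fun v (h : V -> W) => 'D_v h) f vs) x.

(* Smoothness of a map defined on an arbitrary interval I, in the usual sense
   of the existence of a smooth extension to an open neighbourhood of I.  When I
   is nondegenerate, the derivatives at the points of I (end points included) do
   not depend on the extension. *)
Definition smooth_on (R : realType) (W : normedModType R) (I : interval R)
    (c : R -> W) : Prop :=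
  forall s : R, s \in I ->
    \forall t \near s, forall n : nat, derivable (derive1n n c) t 1.

Definition nondegenerate_itv (R : realType) (I : interval R) : Prop :=
  exists a b : R, [/\ a \in I, b \in I & a < b].

Section SL2.
Variable R : realType.

Local Notation E4 := 'rV[R]_4.

Definition vec4 (a b c d : R) : E4 := \row_(j < 4) [:: a; b; c; d]`_j.

Definition crd (v : E4) (k : nat) : R := v ord0 (inord k).

Definition ip (v w : E4) : R :=
  crd v 0 * crd w 0 + crd v 1 * crd w 1 - crd v 2 * crd w 2 - crd v 3 * crd w 3.

(* SL(2,R) = {|z|^2 - |w|^2 = 1} *)
Definition SL2 (p : E4) : Prop := ip p p = 1.

(* With z = p_0 + i p_1 and w = p_2 + i p_3:
   X1 = (i z, i w),  X2 = (i conj w, i conj z),  X3 = (conj w, conj z). *)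
Definition X1 (p : E4) : E4 := vec4 (- crd p 1) (crd p 0) (- crd p 3) (crd p 2).
Definition X2 (p : E4) : E4 := vec4 (crd p 3) (crd p 2) (crd p 1) (crd p 0).
Definition X3 (p : E4) : E4 := vec4 (crd p 2) (- crd p 3) (crd p 0) (- crd p 1).

Definition gmetric (tau : R) (p v w : E4) : R :=
  - ip v w + (1 + tau ^+ 2) * (ip v (X1 p) * ip w (X1 p)).

Definition E1 (tau : R) (p : E4) : E4 := - tau^-1 *: X1 p.
Definition E2 (p : E4) : E4 := X2 p.
Definition E3 (p : E4) : E4 := X3 p.

Definition frame (tau : R) (k : 'I_3) : E4 -> E4 :=
  nth (E1 tau) [:: E1 tau; E2; E3] k.

(* A smooth vector field on SL(2,R) is represented by a smooth map on R^4 that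
   is tangent to SL(2,R) along SL(2,R); since SL(2,R) is closed in R^4, each
   smooth tangent field has such a representative.  Only the values on SL(2,R)
   are meaningful. *)
Definition vector_field (X : E4 -> E4) : Prop :=
  smooth X /\ forall p, SL2 p -> ip p (X p) = 0.

Definition lie_bracket (X Y : E4 -> E4) : E4 -> E4 :=
  fun p => 'D_(X p) Y p - 'D_(Y p) X p.

Record affine_connection (nabla : (E4 -> E4) -> (E4 -> E4) -> E4 -> E4) :
    Prop := {
  connection_field : forall X Y, vector_field X -> vector_field Y ->
    vector_field (nabla X Y);
  (* independence of the chosen representatives *)
  connection_ext : forall X X' Y Y',
    vector_field X -> vector_field X' -> vector_field Y -> vector_field Y' ->
    (forall p, SL2 p -> X p = X' p) -> (forall p, SL2 p -> Y p = Y' p) ->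
    forall p, SL2 p -> nabla X Y p = nabla X' Y' p;
  connection_linl : forall (f : E4 -> R) X X' Y, smooth f ->
    vector_field X -> vector_field X' -> vector_field Y ->
    forall p, SL2 p ->
      nabla (fun q => f q *: X q + X' q) Y p = f p *: nabla X Y p + nabla X' Y p;
  connection_addr : forall X Y Y',
    vector_field X -> vector_field Y -> vector_field Y' ->
    forall p, SL2 p ->
      nabla X (fun q => Y q + Y' q) p = nabla X Y p + nabla X Y' p;
  connection_leibniz : forall (f : E4 -> R) X Y, smooth f ->
    vector_field X -> vector_field Y ->
    forall p, SL2 p ->
      nabla X (fun q => f q *: Y q) p = f p *: nabla X Y p + 'D_(X p) f p *: Y p
}.

Record levi_civita (tau : R) (nabla : (E4 -> E4) -> (E4 -> E4) -> E4 -> E4) :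
    Prop := {
  levi_civita_connection : affine_connection nabla;
  levi_civita_torsion_free : forall X Y, vector_field X -> vector_field Y ->
    forall p, SL2 p -> nabla X Y p - nabla Y X p = lie_bracket X Y p;
  levi_civita_metric : forall X Y Z,
    vector_field X -> vector_field Y -> vector_field Z ->
    forall p, SL2 p ->
      'D_(X p) (fun q => gmetric tau q (Y q) (Z q)) p =
        gmetric tau p (nabla X Y p) (Z p) + gmetric tau p (Y p) (nabla X Z p)
}.

(* The vector field with constant coefficients in the frame (E_i) whose value
   at p is the tangent vector v. *)
Definition extend (tau : R) (p v : E4) : E4 -> E4 :=
  fun q => \sum_(k < 3) gmetric tau p v (frame tau k p) *: frame tau k q.

Section Connection.
Variables (tau : R) (nabla : (E4 -> E4) -> (E4 -> E4) -> E4 -> E4).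

Definition curvature (X Y Z : E4 -> E4) : E4 -> E4 :=
  fun p => nabla X (nabla Y Z) p - nabla Y (nabla X Z) p
           - nabla (lie_bracket X Y) Z p.

(* R being a tensor, its value on vectors at p is computed on any fields
   extending them. *)
Definition curvature_at (p u v w : E4) : E4 :=
  curvature (extend tau p u) (extend tau p v) (extend tau p w) p.

Definition velocity (gam : R -> E4) : R -> E4 := derive1 gam.

(* The covariant derivative along gam of V = \sum_k v_k E_k(gam):
   \sum_k (v_k' E_k(gam) + v_k nabla_{gam'} E_k). *)
Definition covariant_derivative (gam V : R -> E4) : R -> E4 :=
  fun s => \sum_(k < 3)
    (derive1 (fun t => gmetric tau (gam t) (V t) (frame tau k (gam t))) s
       *: frame tau k (gam s)
     + gmetric tau (gam s) (V s) (frame tau k (gam s))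
       *: nabla (extend tau (gam s) (velocity gam s)) (frame tau k) (gam s)).

Definition bitension (gam : R -> E4) : R -> E4 :=
  let T := velocity gam in
  let D := covariant_derivative gam in
  fun s => D (D (D T)) s - curvature_at (gam s) (T s) (D T s) (T s).

Definition geodesic (I : interval R) (gam : R -> E4) : Prop :=
  forall s, s \in I -> covariant_derivative gam (velocity gam) s = 0.

Definition biharmonic (I : interval R) (gam : R -> E4) : Prop :=
  forall s, s \in I -> bitension gam s = 0.

Definition proper_biharmonic (I : interval R) (gam : R -> E4) : Prop :=
  biharmonic I gam /\ ~ geodesic I gam.

End Connection.

Definition SL2_curve (I : interval R) (gam : R -> E4) : Prop :=
  smooth_on I gam /\ forall s, s \in I -> SL2 (gam s).

Definition arc_length_parametrized (tau : R) (I : interval R) (gam : R -> E4) :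
    Prop :=
  forall s, s \in I -> gmetric tau (gam s) (velocity gam s) (velocity gam s) = 1.

Definition angle (tau : R) (p v w : E4) : R :=
  acos (gmetric tau p v w / (Num.sqrt (gmetric tau p v v) * Num.sqrt (gmetric tau p w w))).

End SL2.

(* Main.v *)
Require Import Defs.
From mathcomp Require Import all_boot all_order all_algebra.
From mathcomp Require Import all_classical all_reals all_analysis.
From mathcomp Require Import ring lra.

Set Implicit Arguments.
Unset Strict Implicit.
Unset Printing Implicit Defensive.

Import Order.TTheory GRing.Theory Num.Theory.
Import numFieldNormedType.Exports.

Local Open Scope classical_set_scope.
Local Open Scope ring_scope.

(** The frame E1, E2, E3 trivializes the tangent bundle, so a field with
    constant coefficients in it is a vector of R^3.  On such fields the Koszul
    formula gives nabla_x y = rot x * y, a cross product (nabla_invariant), and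
    hence an explicit curvature tensor (curvature_atE).  A curve becomes the
    triple T = (T1, T2, T3) of the coefficients of its unit tangent field, and
    its biharmonicity becomes a system of ordinary differential equations for T,
    W = D_T T and U = D_T W, closed by D_T U = R(T, W)T.

    Let V be the cross product T * W, so that T, W and V are orthogonal.  Taking
    the scalar product of the last equation with T shows that K = |W|^2, the
    squared curvature of the curve, is constant; K > 0 since the curve is not a
    geodesic.  Taking it with W and with V gives, for q = <U, V>, which is K
    times the torsion,
      K^3 + q^2 = tau^2 K^2 - 4 (1 + tau^2) K V1^2   (torsion_eq),
      q' = - 4 (1 + tau^2) W1 V1                     (is_derive_q),
    while the components along E1 obey T1' = W1 and V1' = (tau - q / K) W1.
    Differentiating the first relation yields (2 q - tau K) W1 V1 = 0; since
    (2 q - tau K)' is a multiple of W1 V1, the square of 2 q - tau K is constant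
    and W1 V1 = 0 (W1V1_eq0).  So q and V1^2 are constant.  Where V1 is nonzero,
    W1 = 0; and if V1 vanishes identically, W1 can only be nonzero when
    q = tau K, which contradicts the first relation (W1_eq0).  Thus T1' = 0: the
    angle with E1 is constant.

    The remaining components satisfy T2^2 + T3^2 = 1 - T1^2, which is positive
    because Hopf fibres are geodesics, and V1 is constant, which forces (T2, T3)
    to rotate at a constant rate (horizontal_rotation).  So beta is affine, and
    in particular smooth, also beyond the end points of the interval.

    At an end point of I the third covariant derivative involves the extension
    of the curve beyond I, which may leave SL(2,R).  The equations are therefore
    used in the interior of I only, and their consequences reach the end points
    by continuity. *)

(** * Constancy and uniqueness of derivatives on an open interval *)

Section OpenInterval.
Context {R : realType}.
Variable O : set R.
Hypotheses (Oopen : open O) (Oitv : is_interval O).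
Implicit Types (f g : R -> R) (t : R).

Lemma is_derive_inj f g t (df dg : R) : O t -> (forall s, O s -> f s = g s) ->
  is_derive t 1 f df -> is_derive t 1 g dg -> df = dg.
Proof.
move=> Ot fg [_ <-] [_ <-]; apply: near_eq_derive.
by near=> s; apply: fg; near: s; exact: open_nbhs_nbhs.
Unshelve. all: by end_near. Qed.

Lemma is_derive0_constant f : (forall t, O t -> is_derive t 1 f 0) ->
  forall s t, O s -> O t -> f s = f t.
Proof.
move=> f0; suff fle s t : O s -> O t -> s <= t -> f s = f t.
  by move=> s t Os Ot; have [|/ltW] := leP s t; [|move=> ts; apply/esym]; exact: fle.
move=> Os Ot st; have Omid x : x \in `[s, t]%R -> O x.
  by rewrite in_itv/= => /andP[sx xt]; apply: (Oitv Os Ot); rewrite sx xt.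
have [||c _ /eqP] := @MVT_segment R f (cst 0) s t st.
- by move=> x xst; apply/f0/Omid/subset_itv_oo_cc.
- apply: derivable_within_continuous => x xst.
  by have [] := f0 x (Omid x xst).
- by rewrite mul0r subr_eq0 => /eqP.
Qed.

End OpenInterval.

(** * Vectors in an orthonormal frame *)

Record triple (R : realType) := Triple { c1 : R; c2 : R; c3 : R }.
Arguments Triple {R}.
Arguments c1 {R}.
Arguments c2 {R}.
Arguments c3 {R}.

Section TripleAlgebra.
Context {R : realType}.
Implicit Types (x y z w : triple R).

Definition taddr x y := Triple (c1 x + c1 y) (c2 x + c2 y) (c3 x + c3 y).
Definition tsubr x y := Triple (c1 x - c1 y) (c2 x - c2 y) (c3 x - c3 y).

Definition dot x y := c1 x * c1 y + c2 x * c2 y + c3 x * c3 y.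

Definition cross x y := Triple (c2 x * c3 y - c3 x * c2 y)
  (c3 x * c1 y - c1 x * c3 y) (c1 x * c2 y - c2 x * c1 y).

Lemma triple_ext x y : c1 x = c1 y -> c2 x = c2 y -> c3 x = c3 y -> x = y.
Proof. by case: x y => [? ? ?] [? ? ?] /= -> -> ->. Qed.

Lemma dotC x y : dot x y = dot y x.
Proof. by rewrite /dot; ring. Qed.

Lemma dotBl x y z : dot (tsubr x y) z = dot x z - dot y z.
Proof. by rewrite /dot/=; ring. Qed.

Lemma dot_eq0 x : (dot x x = 0) -> x = Triple 0 0 0.
Proof.
have := sqr_ge0 (c1 x); have := sqr_ge0 (c2 x); have := sqr_ge0 (c3 x).
rewrite /dot -!expr2 => h3 h2 h1 h; apply: triple_ext => /=; apply/eqP;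
  rewrite -sqrf_eq0 eq_le ?h1 ?h2 ?h3 andbT; lra.
Qed.

(** The expansion in the orthogonal basis x, w, x * w, multiplied by |w|^2 so as
    to need no division. *)
Lemma orthogonal_expansion x w y z : dot x x = 1 -> dot x w = 0 ->
  dot w w * dot y z = dot w w * dot x y * dot x z + dot w y * dot w z
                      + dot y (cross x w) * dot (cross x w) z.
Proof.
move=> xx xw.
have -> : dot w w * dot y z = (dot x x * dot w w - dot x w ^+ 2) * dot y z
    + (1 - dot x x) * dot w w * dot y z + dot x w * dot x w * dot y z by ring.
(* Cramer's rule for x, w, cross x w, whose determinant is this factor. *)
have -> : (dot x x * dot w w - dot x w ^+ 2) * dot y z =
   (dot w w * dot x y - dot x w * dot w y) * dot x z
 + (dot x x * dot w y - dot x w * dot x y) * dot w z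
 + dot y (cross x w) * dot (cross x w) z.
  by rewrite /dot/=; ring.
by rewrite xx xw; ring.
Qed.

Lemma cross_cross x w : dot x x = 1 -> dot x w = 0 ->
  cross x (cross x w) = tsubr (Triple 0 0 0) w.
Proof.
move=> xx xw.
have E c d : c * dot x w - dot x x * d = 0 - d by rewrite xx xw; ring.
apply: triple_ext => /=; [rewrite -(E (c1 x))|rewrite -(E (c2 x))
  |rewrite -(E (c3 x))]; by rewrite /dot; ring.
Qed.

End TripleAlgebra.

(** * The connection and the curvature in the frame *)

Section Connection.
Context {R : realType}.
Variable tau : R.
Implicit Types (x y z w : triple R).

(** For fixed x, the map y |-> nabla_x y on fields with constant coefficients is
    skew because the metric is parallel, so it is a cross product.  The entries
    come from the Koszul formula and the brackets [E1, E2] = - (2 / tau) E3,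
    [E1, E3] = (2 / tau) E2 and [E2, E3] = 2 tau E1. *)
Definition rot x :=
  Triple (- (tau + 2 * tau^-1) * c1 x) (tau * c2 x) (tau * c3 x).

Definition conn x y := cross (rot x) y.

Lemma dot_conn x y z : dot (conn x y) z + dot y (conn x z) = 0.
Proof. by rewrite /dot/=; ring. Qed.

Definition curv x y z :=
  tsubr (tsubr (conn x (conn y z)) (conn y (conn x z)))
        (conn (tsubr (conn x y) (conn y x)) z).

(** The curvature operator is diagonal on bivectors: planes containing E1 have
    sectional curvature tau^2, the plane of E2 and E3 has - 4 - 3 tau^2.  Every
    use of the curvature below goes through this formula. *)
Lemma dot_curv x y z w : tau != 0 ->
  dot (curv x y z) w = 4 * (1 + tau ^+ 2) * c1 (cross x y) * c1 (cross z w)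
    - tau ^+ 2 * dot (cross x y) (cross z w).
Proof. by move=> t0; rewrite /dot/=; field. Qed.

(** DV is the covariant derivative at t of V along a curve whose velocity at t is
    x; stated as a relation so as to carry the differentiability of V too. *)
Definition covD x (V : R -> triple R) (t : R) (DV : triple R) : Prop :=
  [/\ is_derive t 1 (fun s => c1 (V s)) (c1 DV - c1 (conn x (V t))),
      is_derive t 1 (fun s => c2 (V s)) (c2 DV - c2 (conn x (V t))) &
      is_derive t 1 (fun s => c3 (V s)) (c3 DV - c3 (conn x (V t)))].

Lemma covD_dot x (V Y : R -> triple R) t DV DY :
  covD x V t DV -> covD x Y t DY ->
  is_derive t 1 (fun s => dot (V s) (Y s)) (dot DV (Y t) + dot (V t) DY).
Proof.
move=> [V1 V2 V3] [Y1 Y2 Y3]; rewrite /dot.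
apply: is_derive_eq.
by rewrite /dot /= /GRing.scale/=; ring.
Qed.

(** nabla_x is an infinitesimal rotation, hence a derivation of the cross
    product (the Jacobi identity). *)
Lemma covD_cross x (V Y : R -> triple R) t DV DY :
  covD x V t DV -> covD x Y t DY ->
  covD x (fun s => cross (V s) (Y s)) t (taddr (cross DV (Y t)) (cross (V t) DY)).
Proof.
move=> [V1 V2 V3] [Y1 Y2 Y3]; split=> /=; apply: is_derive_eq;
  by rewrite /= /GRing.scale/=; ring.
Qed.

End Connection.

(** * The biharmonic equation in the frame *)

Section BiharmonicEquation.
Context {R : realType}.
Variables (tau : R) (O : set R) (t0 : R) (T W U : R -> triple R).
Hypothesis tau0 : tau != 0.
Hypotheses (Oopen : open O) (Oitv : is_interval O) (Ot0 : O t0).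
Hypothesis unitT : forall t, O t -> dot (T t) (T t) = 1.
Hypothesis DT : forall t, O t -> covD tau (T t) T t (W t).
Hypothesis DW : forall t, O t -> covD tau (T t) W t (U t).
Hypothesis DU : forall t, O t ->
  covD tau (T t) U t (curv tau (T t) (W t) (T t)).

Let tau1 : 1 + tau ^+ 2 != 0.
Proof. by rewrite gt_eqF// ltr_wpDr ?sqr_ge0. Qed.

(* In terms of the Frenet frame (T, N, B), the curvature k and the torsion t of
   the curve, W = k N, V = k B and q = k^2 t. *)
Let V t := cross (T t) (W t).
Let q t := dot (U t) (V t).

Lemma dot_TW t : O t -> dot (T t) (W t) = 0.
Proof.
move=> Ot; have := is_derive_inj Oopen Ot unitT (covD_dot (DT Ot) (DT Ot))
  (is_derive_cst _ _ _).
by rewrite (dotC (W t)); lra.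
Qed.

Lemma dot_TU t : O t -> dot (T t) (U t) = - dot (W t) (W t).
Proof.
move=> Ot; have := is_derive_inj Oopen Ot dot_TW (covD_dot (DT Ot) (DW Ot))
  (is_derive_cst _ _ _).
lra.
Qed.

(** The tangential part of the equation: D_T U = R(T, W)T is orthogonal to T,
    whereas metric compatibility gives <T, D_T U> = - 3 <W, U>. *)
Lemma dot_WU t : O t -> dot (W t) (U t) = 0.
Proof.
move=> Ot; have := is_derive_inj Oopen Ot dot_TU (covD_dot (DT Ot) (DU Ot))
  (is_deriveN (covD_dot (DW Ot) (DW Ot))).
have -> : dot (T t) (curv tau (T t) (W t) (T t)) = 0.
  by rewrite dotC dot_curv// /dot/=; ring.
by rewrite (dotC (U t)); lra.
Qed.

Let K := dot (W t0) (W t0).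

Lemma dot_WW t : O t -> dot (W t) (W t) = K.
Proof.
move=> Ot; apply: (is_derive0_constant (f := fun s => dot (W s) (W s))
  Oitv _ Ot Ot0) => s Os.
apply: is_derive_eq (covD_dot (DW Os) (DW Os)) _.
by rewrite (dotC (U s)) dot_WU// addr0.
Qed.

Lemma dot_expand t y z : O t -> K * dot y z =
  K * dot (T t) y * dot (T t) z + dot (W t) y * dot (W t) z
  + dot y (V t) * dot (V t) z.
Proof.
move=> Ot; rewrite -(dot_WW Ot).
exact: orthogonal_expansion (unitT Ot) (dot_TW Ot).
Qed.

Lemma dot_VV t : O t -> dot (V t) (V t) = K.
Proof.
move=> Ot; have -> : dot (V t) (V t) =
    dot (T t) (T t) * dot (W t) (W t) - dot (T t) (W t) ^+ 2.
  by rewrite /V /dot/=; ring.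
by rewrite unitT// dot_TW// dot_WW//; ring.
Qed.

(** The part of the equation along W.  Up to the factor K^2 it says that the sum
    of the squares of curvature and torsion is the sectional curvature of the
    osculating plane. *)
Lemma torsion_eq t : O t ->
  K ^+ 3 + q t ^+ 2 =
  tau ^+ 2 * K ^+ 2 - 4 * (1 + tau ^+ 2) * K * c1 (V t) ^+ 2.
Proof.
move=> Ot; have := is_derive_inj Oopen Ot dot_WU
  (covD_dot (DW Ot) (DU Ot)) (is_derive_cst _ _ _).
have -> : dot (W t) (curv tau (T t) (W t) (T t)) =
    4 * (1 + tau ^+ 2) * c1 (V t) ^+ 2 - tau ^+ 2 * K.
  by rewrite -(dot_VV Ot) dotC dot_curv// /V /dot/=; ring.
move=> UU; have := dot_expand (U t) (U t) Ot.
rewrite dot_TU// dot_WU// dot_WW// (dotC (V t)) -/(q t) => KUU.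
have -> : q t ^+ 2 = K * dot (U t) (U t) - K ^+ 3 by rewrite KUU; ring.
rewrite (_ : dot (U t) (U t) = tau ^+ 2 * K - 4 * (1 + tau ^+ 2) * c1 (V t) ^+ 2).
  by ring.
by move: UU; lra.
Qed.

(** The part of the equation along V: since D_T V = T * U, the other term
    <U, D_T V> of the derivative drops out. *)
Lemma is_derive_q t : O t ->
  is_derive t 1 q (- (4 * (1 + tau ^+ 2) * c1 (W t) * c1 (V t))).
Proof.
move=> Ot.
apply: is_derive_eq (covD_dot (DU Ot) (covD_cross (DT Ot) (DW Ot))) _.
rewrite dot_curv// cross_cross ?unitT ?dot_TW//.
by rewrite /V /dot/=; ring.
Qed.

Hypothesis K0 : K != 0.

(** The E1-component of D_T V = T * U, where T * U = - (q / K) W because U lies in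
    the plane of T and V; the term tau W1 comes from the rotation of the frame
    itself along the curve. *)
Lemma is_derive_V1 t : O t ->
  is_derive t 1 (fun s => c1 (V s)) ((tau - q t / K) * c1 (W t)).
Proof.
move=> Ot; have [+ _ _] := covD_cross (DT Ot) (DW Ot).
move=> /is_derive_eq; apply.
pose e := Triple (1 : R) 0 0.
have -> : c1 (taddr (cross (W t) (W t)) (cross (T t) (U t)))
    = dot (U t) (cross e (T t)) by rewrite /dot/=; ring.
have -> : c1 (conn tau (T t) (cross (T t) (W t))) =
    tau * c1 (cross (T t) (cross (T t) (W t))) by rewrite /=; ring.
(* The mixed product turns a component of T * U into a scalar product of U,
   to which the orthogonal expansion applies. *)
have VeT : dot (V t) (cross e (T t)) = c1 (cross (T t) (cross (T t) (W t))).
  by rewrite /dot/=; ring.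
apply: (mulfI K0); rewrite mulrBr (dot_expand _ _ Ot) dot_WU//.
rewrite VeT (_ : dot (T t) (cross e (T t)) = 0); last by rewrite /dot/=; ring.
rewrite -/(q t) cross_cross ?unitT ?dot_TW//=.
by field.
Qed.

(** Differentiating torsion_eq gives h W1 V1 = 0, where h' is a multiple of W1 V1.
    Hence h^2 is constant: either h never vanishes, or it vanishes identically
    and so does h'. *)
Lemma W1V1_eq0 t : O t -> c1 (W t) * c1 (V t) = 0.
Proof.
pose h s := 2 * q s - tau * K.
have Dh s : O s ->
    is_derive s 1 h (- (8 * (1 + tau ^+ 2) * (c1 (W s) * c1 (V s)))).
  move=> Os; have dq := is_derive_q Os; apply: is_derive_eq.
  by rewrite /GRing.scale/=; ring.
have hWV s : O s -> h s * (c1 (W s) * c1 (V s)) = 0.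
  move=> Os; have dq := is_derive_q Os; have dV := is_derive_V1 Os.
  have dl : is_derive s 1 (fun s => K ^+ 3 + q s ^+ 2)
      (- (8 * (1 + tau ^+ 2) * q s * (c1 (W s) * c1 (V s)))).
    by apply: is_derive_eq; rewrite /GRing.scale/=; ring.
  have dr : is_derive s 1 (fun s => tau ^+ 2 * K ^+ 2
      - 4 * (1 + tau ^+ 2) * K * c1 (V s) ^+ 2)
      (- (8 * (1 + tau ^+ 2) * (tau * K - q s) * (c1 (W s) * c1 (V s)))).
    by apply: is_derive_eq; rewrite /GRing.scale/=; field.
  have := is_derive_inj Oopen Os torsion_eq dl dr; rewrite /h => E.
  have t2 : 8 * (1 + tau ^+ 2) != 0 by rewrite mulf_neq0.
  by apply: (mulfI t2); rewrite mulr0; lra.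
have h2 s : O s -> h s ^+ 2 = h t0 ^+ 2.
  move=> Os; apply: (is_derive0_constant (f := fun r => h r ^+ 2) Oitv _ Os Ot0) => r Or.
  have dh := Dh _ Or; apply: is_derive_eq; rewrite /GRing.scale/=.
  by rewrite -[RHS](mulr0 (- (16 * (1 + tau ^+ 2)))) -(hWV r Or) /V/=; ring.
move=> Ot; have [h0|h0] := eqVneq (h t0) 0.
  have := is_derive_inj Oopen Ot (_ : forall s, O s -> h s = cst 0 s) (Dh _ Ot)
    (is_derive_cst _ _ _).
  have hs s : O s -> h s = cst 0 s.
    by move=> Os; apply/eqP; rewrite /cst -sqrf_eq0 h2// h0 expr0n.
  move=> /(_ hs) /eqP; rewrite oppr_eq0 mulf_eq0 => /orP[|/eqP//].
  by rewrite mulf_eq0 (negbTE tau1) orbF pnatr_eq0.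
have /eqP := hWV _ Ot; rewrite mulf_eq0 => /orP[|/eqP//].
by rewrite -sqrf_eq0 h2// sqrf_eq0 (negbTE h0).
Qed.

Lemma q_constant t : O t -> q t = q t0.
Proof.
move=> Ot; apply: (is_derive0_constant (f := q) Oitv _ Ot Ot0) => s Os.
apply: is_derive_eq (is_derive_q Os) _.
by rewrite -mulrA W1V1_eq0// mulr0 oppr0.
Qed.

(** V1^2 is constant.  If V1 vanishes identically then so does its derivative
    (tau - q / K) W1, and q = tau K would turn torsion_eq into K^3 = 0. *)
Lemma W1_eq0 t : O t -> c1 (W t) = 0.
Proof.
have V2 s : O s -> c1 (V s) ^+ 2 = c1 (V t0) ^+ 2.
  move=> Os; have := torsion_eq Os; rewrite q_constant// torsion_eq//.
  have t2 : - (4 * (1 + tau ^+ 2) * K) != 0.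
    by rewrite oppr_eq0 !mulf_neq0.
  by move=> E; apply: (mulfI t2); lra.
move=> Ot; have /eqP := W1V1_eq0 Ot; rewrite mulf_eq0 => /orP[/eqP//|].
rewrite -sqrf_eq0 V2// => V0.
have Vs s : O s -> c1 (V s) = cst 0 s.
  by move=> Os; apply/eqP; rewrite /cst -sqrf_eq0 V2.
have /eqP := is_derive_inj Oopen Ot Vs (is_derive_V1 Ot) (is_derive_cst _ _ _).
rewrite mulf_eq0 => /orP[/eqP qK|/eqP//].
have := torsion_eq Ot; rewrite Vs//.
have -> : q t = tau * K by rewrite -[tau](subrK (q t / K)) qK; field.
move=> E; have /eqP : K ^+ 3 = 0 by move: E; rewrite /cst; lra.
by rewrite expf_eq0 (negbTE K0).
Qed.

Lemma T1_constant t : O t -> c1 (T t) = c1 (T t0).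
Proof.
move=> Ot; apply: (is_derive0_constant (f := fun s => c1 (T s)) Oitv _ Ot Ot0) => s Os.
have [+ _ _] := DT Os; move=> /is_derive_eq; apply.
by rewrite W1_eq0//=; ring.
Qed.

Lemma V1_constant t : O t -> c1 (V t) = c1 (V t0).
Proof.
move=> Ot; apply: (is_derive0_constant (f := fun s => c1 (V s)) Oitv _ Ot Ot0) => s Os.
by apply: is_derive_eq (is_derive_V1 Os) _; rewrite W1_eq0// mulr0.
Qed.

(** If T1^2 = 1 the curve is a Hopf fibre, for which W = 0. *)
Lemma T1_lt1 : c1 (T t0) ^+ 2 < 1.
Proof.
have := unitT Ot0; rewrite /dot -!expr2 => TT.
have := sqr_ge0 (c2 (T t0)); have := sqr_ge0 (c3 (T t0)) => T3 T2.
rewrite lt_neqAle; apply/andP; split; last by lra.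
apply/eqP => T1; move/eqP: K0; apply.
have T0 t : O t -> c2 (T t) = cst 0 t /\ c3 (T t) = cst 0 t.
  move=> Ot; have := unitT Ot; rewrite /dot -!expr2 T1_constant// => TTt.
  have := sqr_ge0 (c2 (T t)); have := sqr_ge0 (c3 (T t)) => T3t T2t.
  by split; apply/eqP; rewrite /cst -sqrf_eq0; apply/eqP; lra.
have [T20 T30] := T0 _ Ot0.
have [_ D2 D3] := DT Ot0.
have E2 := is_derive_inj Oopen Ot0 (fun t Ot => (T0 t Ot).1) D2 (is_derive_cst _ _ _).
have E3 := is_derive_inj Oopen Ot0 (fun t Ot => (T0 t Ot).2) D3 (is_derive_cst _ _ _).
move: E2 E3; rewrite /K /dot W1_eq0//= T20 T30 /cst => E2 E3.
have -> : c2 (W t0) = 0 by lra.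
have -> : c3 (W t0) = 0 by lra.
ring.
Qed.

(** In the plane of E2 and E3, the vector (W2, W3) is orthogonal to (T2, T3) and
    its cross product with it is the constant V1; and (T2, T3) has constant
    length.  So (W2, W3) is a constant multiple of (- T3, T2). *)
Lemma horizontal_rotation : exists lam : R, forall t, O t ->
  is_derive t 1 (fun s => c2 (T s)) (- lam * c3 (T t)) /\
  is_derive t 1 (fun s => c3 (T s)) (lam * c2 (T t)).
Proof.
pose v := c1 (V t0); pose a := c1 (T t0).
have r0 : 1 - a ^+ 2 != 0 by rewrite gt_eqF// subr_gt0 T1_lt1.
(* The part of the rotation due to the frame: the E2- and E3-components of
   conn T T are m T1 T3 and - m T1 T2. *)
pose m := tau + (tau + 2 * tau^-1).
exists (v / (1 - a ^+ 2) + m * a) => t Ot.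
have [_ D2 D3] := DT Ot.
have Tt := T1_constant Ot; have Wt := W1_eq0 Ot; have TW := dot_TW Ot.
have TT := unitT Ot.
have Vt : c2 (T t) * c3 (W t) - c3 (T t) * c2 (W t) = v.
  by rewrite /v -(V1_constant Ot).
move: TW TT; rewrite /dot Wt mulr0 add0r Tt -/a => TW TT.
have rr : 1 - a ^+ 2 = c2 (T t) * c2 (T t) + c3 (T t) * c3 (T t) by lra.
have rW2 : (1 - a ^+ 2) * c2 (W t) = - c3 (T t) * v.
  have -> : (1 - a ^+ 2) * c2 (W t) =
      c2 (T t) * (c2 (T t) * c2 (W t) + c3 (T t) * c3 (W t))
      - c3 (T t) * (c2 (T t) * c3 (W t) - c3 (T t) * c2 (W t)).
    by rewrite rr; ring.
  by rewrite TW Vt; ring.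
have rW3 : (1 - a ^+ 2) * c3 (W t) = c2 (T t) * v.
  have -> : (1 - a ^+ 2) * c3 (W t) =
      c3 (T t) * (c2 (T t) * c2 (W t) + c3 (T t) * c3 (W t))
      + c2 (T t) * (c2 (T t) * c3 (W t) - c3 (T t) * c2 (W t)).
    by rewrite rr; ring.
  by rewrite TW Vt; ring.
split; [move: D2|move: D3] => /is_derive_eq; apply; apply: (mulfI r0);
  by rewrite /= Tt -/a mulrBr ?rW2 ?rW3 /m; field; rewrite r0 tau0.
Qed.

End BiharmonicEquation.

(** * The Levi-Civita connection in the frame *)

Section Coordinates.
Context {R : realType}.
Local Notation E4 := 'rV[R]_4.
Implicit Types (p q v w : E4) (x y z : triple R).

Lemma crd_vec4 a b c d :
  ((crd (vec4 a b c d : E4) 0 = a) * (crd (vec4 a b c d : E4) 1 = b)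
  * (crd (vec4 a b c d : E4) 2 = c) * (crd (vec4 a b c d : E4) 3 = d))%type.
Proof. by rewrite /crd /vec4 !mxE !inordK. Qed.

Lemma vec4_eq v w : crd v 0 = crd w 0 -> crd v 1 = crd w 1 ->
  crd v 2 = crd w 2 -> crd v 3 = crd w 3 -> v = w.
Proof.
move=> h0 h1 h2 h3; apply/rowP => i; rewrite -(inord_val i).
by case: i => -[|[|[|[|//]]]].
Qed.

Lemma crdD v w k : crd (v + w) k = crd v k + crd w k.
Proof. by rewrite /crd mxE. Qed.
Lemma crdN v k : crd (- v) k = - crd v k.
Proof. by rewrite /crd mxE. Qed.
Lemma crdZ a v k : crd (a *: v) k = a * crd v k.
Proof. by rewrite /crd mxE. Qed.
Lemma crd0 k : crd (0 : E4) k = 0.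
Proof. by rewrite /crd mxE. Qed.

Definition crdE := (crdD, crdN, crdZ, crd0, crd_vec4).

Variable tau : R.

Definition invariant_field x : E4 -> E4 :=
  fun q => c1 x *: E1 tau q + c2 x *: E2 q + c3 x *: E3 q.

Definition coef p v : triple R := Triple (gmetric tau p v (E1 tau p))
  (gmetric tau p v (E2 p)) (gmetric tau p v (E3 p)).

Lemma extendE p v : extend tau p v = invariant_field (coef p v).
Proof.
by apply/funext => q; rewrite /extend !big_ord_recl big_ord0 addr0 addrA.
Qed.

Lemma frameE (k : 'I_3) : frame tau k =
  invariant_field (Triple (k == 0 :> nat)%:R (k == 1 :> nat)%:R (k == 2 :> nat)%:R).
Proof.
apply/funext => q; rewrite /invariant_field /=.
by case: k => -[|[|[|//]]] k3 /=; rewrite !scale0r !scale1r ?addr0 ?add0r.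
Qed.

Lemma invariant_fieldB p x y :
  invariant_field (tsubr x y) p = invariant_field x p - invariant_field y p.
Proof. by apply: vec4_eq; rewrite /invariant_field !crdE /=; ring. Qed.

(** Away from SL(2,R) the scalar products of the frame are not constant: they are
    functions of the ambient form ip p p. *)
Lemma gmetric_invariant p x y : tau != 0 ->
  gmetric tau p (invariant_field x p) (invariant_field y p) =
    tau ^- 2 * ((1 + tau ^+ 2) * ip p p ^+ 2 - ip p p) * (c1 x * c1 y)
    + ip p p * (c2 x * c2 y + c3 x * c3 y).
Proof.
move=> t0; rewrite /gmetric /invariant_field /E1 /E2 /E3 /ip !crdE.
by field.
Qed.

Lemma gmetric_SL2 p x y : tau != 0 -> SL2 p ->
  gmetric tau p (invariant_field x p) (invariant_field y p) = dot x y.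
Proof.
by rewrite /SL2 => t0 p1; rewrite gmetric_invariant// p1 /dot; field.
Qed.

Lemma E1E : E1 tau = invariant_field (Triple 1 0 0).
Proof. exact: frameE (Ordinal (isT : 0 < 3)%N). Qed.

Lemma E2E : @E2 R = invariant_field (Triple 0 1 0).
Proof. exact: frameE (Ordinal (isT : 1 < 3)%N). Qed.

Lemma E3E : @E3 R = invariant_field (Triple 0 0 1).
Proof. exact: frameE (Ordinal (isT : 2 < 3)%N). Qed.

Lemma coef_invariant p x : tau != 0 -> SL2 p -> coef p (invariant_field x p) = x.
Proof.
move=> t0 p1; rewrite /coef E1E E2E E3E !gmetric_SL2//.
by apply: triple_ext; rewrite /dot/=; ring.
Qed.

Lemma invariant_field_inj p : tau != 0 -> SL2 p ->
  injective (invariant_field ^~ p).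
Proof.
by move=> t0 hp x y /(congr1 (coef p)); rewrite !coef_invariant.
Qed.

Lemma coef_ip p v : tau != 0 -> SL2 p ->
  coef p v = Triple (- tau * ip v (X1 p)) (- ip v (X2 p)) (- ip v (X3 p)).
Proof.
move=> t0 p1; apply: triple_ext => /=.
- have -> : gmetric tau p v (E1 tau p) =
      tau^-1 * (1 - (1 + tau ^+ 2) * ip p p) * ip v (X1 p).
    by rewrite /gmetric /E1 /ip !crdE; ring.
  by rewrite (_ : ip p p = 1)//; field.
- by rewrite /gmetric /E2 /ip !crdE; ring.
- by rewrite /gmetric /E3 /ip !crdE; ring.
Qed.

Lemma invariant_coef p v : tau != 0 -> SL2 p -> ip p v = 0 ->
  invariant_field (coef p v) p = v.
Proof.
move=> t0 p1 pv; rewrite coef_ip// /invariant_field/=.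
have -> : (- tau * ip v (X1 p)) *: E1 tau p = ip v (X1 p) *: X1 p.
  by rewrite /E1 scalerA; congr (_ *: _); field.
have E : ip v (X1 p) *: X1 p + - ip v (X2 p) *: E2 p + - ip v (X3 p) *: E3 p
    = ip p p *: v - ip p v *: p.
  by apply: vec4_eq; rewrite /E2 /E3 /ip !crdE; ring.
by rewrite E pv (_ : ip p p = 1)// scale1r scale0r subr0.
Qed.

Lemma ip_invariant p x : ip p (invariant_field x p) = 0.
Proof. by rewrite /ip /invariant_field !crdE; ring. Qed.

Lemma differentiable_invariant x v : differentiable (invariant_field x) v.
Proof.
pose F k (e : E4) := fun q : E4 => crd q k *: invariant_field x e.
have -> : invariant_field x = F 0%N (vec4 1 0 0 0) + F 1%N (vec4 0 1 0 0)
    + F 2%N (vec4 0 0 1 0) + F 3%N (vec4 0 0 0 1).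
  apply/funext => q; rewrite !fctE /F.
  by apply: vec4_eq; rewrite /invariant_field !crdE; ring.
have dF k e : differentiable (F k e) v.
  by apply: differentiableZl; exact: differentiable_coord.
by do !apply: differentiableD.
Qed.

Lemma derive_invariant x p v : 'D_v (invariant_field x) p = invariant_field x v.
Proof.
rewrite /derive; apply: lim_near_cst => //; near=> h.
have h0 : h != 0 by near: h; exact: nbhs_dnbhs_neq.
have -> : invariant_field x (h *: v + p) - invariant_field x p =
    h *: invariant_field x v.
  by apply: vec4_eq; rewrite /invariant_field !crdE; ring.
by rewrite scalerA mulVf// scale1r.
Unshelve. all: by end_near. Qed.

(** The field is linear, so its first derivatives are constant fields and the
    further ones vanish. *)
Lemma smooth_invariant x : smooth (invariant_field x).
Proof.
move=> vs; have : foldr (fun v (h : E4 -> E4) => 'D_v h) (invariant_field x) vs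
    = invariant_field x \/ exists c,
    foldr (fun v (h : E4 -> E4) => 'D_v h) (invariant_field x) vs = cst c.
  elim: vs => [|v vs [IH|[c IH]]] /=; [by left| |]; right; rewrite IH.
    by exists (invariant_field x v); apply/funext => p; exact: derive_invariant.
  by exists 0; apply/funext => p; exact: derive_cst.
by case=> [|[c]] -> p; [exact: differentiable_invariant|exact: differentiable_cst].
Qed.

Lemma vector_field_invariant x : vector_field (invariant_field x).
Proof. by split=> [|p _]; [exact: smooth_invariant|exact: ip_invariant]. Qed.

Lemma lie_bracket_invariant x y : tau != 0 ->
  lie_bracket (invariant_field x) (invariant_field y) =
  invariant_field (tsubr (conn tau x y) (conn tau y x)).
Proof.
move=> t0; apply/funext => p; rewrite /lie_bracket !derive_invariant.
apply: vec4_eq; rewrite /invariant_field !crdE /=; rewrite ?crdE; by field.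
Qed.

Lemma derive_line (F : E4 -> R) p v :
  'D_v F p = 'D_1 (fun h : R => F (h *: v + p)) (0 : R).
Proof.
rewrite /derive; set f := (X in lim (X @ _) = _).
set g := (X in _ = lim (X @ _)); suff -> : f = g by [].
by apply/funext => h; rewrite /f /g /= scale0r add0r addr0 [h *: 1]mulr1.
Qed.

(** The scalar products are functions of ip q q, which is stationary at p in the
    directions tangent to SL(2,R). *)
Lemma derive_gmetric_invariant x y p v : tau != 0 -> SL2 p -> ip p v = 0 ->
  'D_v (fun q => gmetric tau q (invariant_field x q) (invariant_field y q)) p = 0.
Proof.
move=> t0 p1 pv; rewrite derive_line.
(* Along p + h v, with v tangent, ip takes the value 1 + h^2 ip v v. *)
pose b := tau ^- 2 * (c1 x * c1 y); pose c := c2 x * c2 y + c3 x * c3 y.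
have -> : (fun h : R => gmetric tau (h *: v + p)
      (invariant_field x (h *: v + p)) (invariant_field y (h *: v + p))) =
    (fun h => b * ((1 + tau ^+ 2) * (1 + h ^+ 2 * ip v v) ^+ 2
      - (1 + h ^+ 2 * ip v v)) + c * (1 + h ^+ 2 * ip v v)).
  apply/funext => h; rewrite gmetric_invariant//.
  have -> : ip (h *: v + p) (h *: v + p) =
      ip p p + 2 * h * ip p v + h ^+ 2 * ip v v.
    by rewrite /ip !crdE; ring.
  by rewrite (_ : ip p p = 1)// pv /b /c; ring.
apply: derive_val; apply: is_derive_eq; rewrite /GRing.scale/=; ring.
Qed.

Variable nabla : (E4 -> E4) -> (E4 -> E4) -> E4 -> E4.
Hypothesis hnabla : levi_civita tau nabla.
Hypothesis tau0 : tau != 0.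

Local Notation inv := invariant_field.

Lemma nabla_tangent X Y p : vector_field X -> vector_field Y -> SL2 p ->
  ip p (nabla X Y p) = 0.
Proof.
move=> hX hY hp.
by have [_ ->] := connection_field (levi_civita_connection hnabla) hX hY.
Qed.

(** The uniqueness part of the fundamental theorem of Riemannian geometry: the
    difference H of two metric torsion-free connections on the frame gives a
    form <H a b, c> symmetric in a, b and skew in b, c, hence zero. *)
Lemma nabla_invariant x y p : SL2 p -> nabla (inv x) (inv y) p = inv (conn tau x y) p.
Proof.
move=> hp; pose G x y := coef p (nabla (inv x) (inv y) p).
have GE a b : nabla (inv a) (inv b) p = inv (G a b) p.
  rewrite /G invariant_coef// nabla_tangent//; exact: vector_field_invariant.
rewrite GE; congr (inv _ p).
have torsion a b : tsubr (G a b) (G b a) = tsubr (conn tau a b) (conn tau b a).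
  have := levi_civita_torsion_free hnabla (vector_field_invariant a)
    (vector_field_invariant b) hp.
  rewrite lie_bracket_invariant// !GE -invariant_fieldB.
  exact: invariant_field_inj.
have metric a b c : dot (G a b) c + dot b (G a c) = 0.
  have := levi_civita_metric hnabla (vector_field_invariant a)
    (vector_field_invariant b) (vector_field_invariant c) hp.
  by rewrite derive_gmetric_invariant ?ip_invariant// !GE !gmetric_SL2.
pose H a b := tsubr (G a b) (conn tau a b).
have Hsym a b : H a b = H b a.
  have := torsion a b; rewrite /H; case: (G a b) (G b a) => [? ? ?] [? ? ?].
  by move=> [e1 e2 e3]; apply: triple_ext; move: e1 e2 e3 => /=; lra.
have Hskew a b c : dot (H a b) c = - dot (H a c) b.
  have := metric a b c; have := dot_conn tau a b c.
  rewrite /H !dotBl (dotC b (G a c)) (dotC b (conn tau a c)); lra.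
have H0 a b c : dot (H a b) c = 0.
  have := Hskew a b c; have := Hskew c a b; have := Hskew b c a.
  rewrite (Hsym c a) (Hsym c b) (Hsym b a); lra.
have := dot_eq0 (H0 x y _); rewrite /H; case: (G x y) => [? ? ?] [e1 e2 e3].
by apply: triple_ext => /=; move: e1 e2 e3; lra.
Qed.

(** The inner derivative nabla Y Z is known on SL(2,R) only; that the connection
    does not depend on representatives allows the substitution. *)
Lemma curvature_atE p u v w : SL2 p ->
  curvature_at tau nabla p u v w =
  inv (curv tau (coef p u) (coef p v) (coef p w)) p.
Proof.
move=> hp; rewrite /curvature_at /curvature !extendE lie_bracket_invariant//.
have nabla2 x y z : nabla (inv x) (nabla (inv y) (inv z)) p =
    inv (conn tau x (conn tau y z)) p.
  rewrite -nabla_invariant//.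
  have hc := levi_civita_connection hnabla.
  apply: (connection_ext hc _ _ _ _ _ _ hp) => //; try exact: vector_field_invariant.
  - by apply: (connection_field hc); exact: vector_field_invariant.
  - exact: nabla_invariant.
by rewrite !nabla2 nabla_invariant// /curv !invariant_fieldB.
Qed.

Definition dtriple (V : R -> triple R) (s : R) : triple R :=
  Triple (derive1 (fun t => c1 (V t)) s) (derive1 (fun t => c2 (V t)) s)
         (derive1 (fun t => c3 (V t)) s).

Lemma covariant_derivativeE (gam V : R -> E4) s : SL2 (gam s) ->
  covariant_derivative tau nabla gam V s =
  inv (taddr (dtriple (fun t => coef (gam t) (V t)) s)
        (conn tau (coef (gam s) (velocity gam s)) (coef (gam s) (V s)))) (gam s).
Proof.
move=> hs; rewrite /covariant_derivative.
under eq_bigr => k _ do rewrite extendE (frameE k) nabla_invariant// -(frameE k).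
rewrite !big_ord_recl big_ord0 addr0 /=.
apply: vec4_eq; rewrite /invariant_field !crdE /=; ring.
Qed.

End Coordinates.

(** * Smooth functions on an open set *)

Section TimesDerivable.
Context {R : realType}.
Variable J : set R.
Hypothesis Jopen : open J.
Implicit Types f g : R -> R.

(** The derivative is taken at each stage on all of R, but only its values on J
    matter (times_derivable_eq), which makes induction on the order possible. *)
Fixpoint times_derivable n f : Prop :=
  if n is m.+1 then (forall t, J t -> derivable f t 1) /\ times_derivable m (derive1 f)
  else True.

Definition smooth_in f := forall n, times_derivable n f.

Lemma derive1_eq_in f g : (forall t, J t -> f t = g t) ->
  forall t, J t -> (derive1 f) t = (derive1 g) t.
Proof.
move=> fg t Jt; rewrite !derive1E; apply: near_eq_derive.
by near=> s; apply: fg; near: s; exact: open_nbhs_nbhs.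
Unshelve. all: by end_near. Qed.

Lemma times_derivable_eq n f g : (forall t, J t -> f t = g t) ->
  times_derivable n f -> times_derivable n g.
Proof.
elim: n f g => //= n IH f g fg [df nf]; split; last first.
  by apply: IH nf => t; exact: derive1_eq_in.
move=> t Jt; apply: near_eq_derivable (df t Jt).
by near=> s; apply: fg; near: s; exact: open_nbhs_nbhs.
Unshelve. all: by end_near. Qed.

Lemma times_derivableW n f : times_derivable n.+1 f -> times_derivable n f.
Proof. by elim: n f => //= n IH f [df nf]; split=> //; exact: IH. Qed.

Lemma times_derivableD n f g : times_derivable n f -> times_derivable n g ->
  times_derivable n (fun t => f t + g t).
Proof.
elim: n f g => //= n IH f g [df nf] [dg ng]; split.
  by move=> t Jt; apply: derivableD; [exact: df|exact: dg].
apply: times_derivable_eq (IH _ _ nf ng) => t Jt.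
by rewrite !derive1E deriveD//; [exact: df|exact: dg].
Qed.

Lemma times_derivableM n f g : times_derivable n f -> times_derivable n g ->
  times_derivable n (fun t => f t * g t).
Proof.
elim: n f g => // n IH f g hf hg; split=> [t Jt|].
  by apply: derivableM; [exact: hf.1|exact: hg.1].
have := times_derivableD (IH _ _ (times_derivableW hf) hg.2)
  (IH _ _ (times_derivableW hg) hf.2).
apply: times_derivable_eq => t Jt.
rewrite !derive1E deriveM//; [exact: hf.1|exact: hg.1].
Qed.

Lemma smooth_in_cst c : smooth_in (cst c).
Proof.
move=> n; elim: n c => //= n IH c; split=> [t _|]; first exact: derivable_cst.
by apply: times_derivable_eq (IH 0) => t _; rewrite derive1_cst.
Qed.

Lemma smooth_inD f g : smooth_in f -> smooth_in g ->
  smooth_in (fun t => f t + g t).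
Proof. by move=> hf hg n; exact: times_derivableD. Qed.

Lemma smooth_inM f g : smooth_in f -> smooth_in g ->
  smooth_in (fun t => f t * g t).
Proof. by move=> hf hg n; exact: times_derivableM. Qed.

Lemma smooth_inN f : smooth_in f -> smooth_in (fun t => - f t).
Proof.
move=> hf; have -> : (fun t => - f t) = (fun t => cst (-1) t * f t).
  by apply/funext => t; rewrite mulN1r.
by apply: smooth_inM => //; exact: smooth_in_cst.
Qed.

Lemma smooth_in_derive1 f : smooth_in f -> smooth_in (derive1 f).
Proof. by move=> hf n; exact: (hf n.+1).2. Qed.

Lemma smooth_in_derivable f t : smooth_in f -> J t -> derivable f t 1.
Proof. by move=> hf; exact: (hf 1%N).1. Qed.

Lemma smooth_in_continuous f t : smooth_in f -> J t -> {for t, continuous f}.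
Proof.
by move=> hf Jt; apply/differentiable_continuous/derivable1_diffP/smooth_in_derivable.
Qed.

Lemma smooth_in_crd (gam : R -> 'rV[R]_4) k :
  (forall t, J t -> forall n, derivable (derive1n n gam) t 1) ->
  smooth_in (fun t => crd (gam t) k).
Proof.
move=> + n; elim: n gam => // n IH gam hgam; split=> [t Jt|].
  by have /derivable_mxP := hgam t Jt 0%N; apply.
have hd : forall t, J t -> forall m, derivable (derive1n m (derive1 gam)) t 1.
  by move=> t Jt m; rewrite -derive1Sn; exact: hgam.
apply: times_derivable_eq (IH _ hd) => t Jt; rewrite /crd !derive1E derive_mx ?mxE//.
exact: hgam Jt 0%N.
Qed.

End TimesDerivable.

(** * Curves in the frame *)

Section TripleCurves.
Context {R : realType}.
Variables (tau : R) (J : set R).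
Hypothesis Jopen : open J.

Definition smooth_triple (V : R -> triple R) : Prop :=
  [/\ smooth_in J (fun t => c1 (V t)), smooth_in J (fun t => c2 (V t)) &
      smooth_in J (fun t => c3 (V t))].

Definition smooth_vec4 (V : R -> 'rV[R]_4) : Prop :=
  [/\ smooth_in J (fun t => crd (V t) 0), smooth_in J (fun t => crd (V t) 1),
      smooth_in J (fun t => crd (V t) 2) & smooth_in J (fun t => crd (V t) 3)].

Ltac smooth_arith := repeat first [assumption
  | apply: (smooth_inD Jopen) | apply: (smooth_inM Jopen)
  | apply: (smooth_inN Jopen) | exact: (smooth_in_cst Jopen)].

Lemma smooth_ip V Y : smooth_vec4 V -> smooth_vec4 Y ->
  smooth_in J (fun t => ip (V t) (Y t)).
Proof. by move=> [? ? ? ?] [? ? ? ?]; rewrite /ip; smooth_arith. Qed.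

Lemma smooth_invariant_along gam x : smooth_vec4 gam ->
  smooth_vec4 (fun t => invariant_field tau x (gam t)).
Proof.
move=> [g0 g1 g2 g3]; split.
- have -> : (fun t => crd (invariant_field tau x (gam t)) 0) =
    (fun t => c1 x * tau^-1 * crd (gam t) 1 + c2 x * crd (gam t) 3 + c3 x * crd (gam t) 2).
    by apply/funext => t; rewrite /invariant_field !crdE; ring.
  by smooth_arith.
- have -> : (fun t => crd (invariant_field tau x (gam t)) 1) =
    (fun t => - (c1 x * tau^-1) * crd (gam t) 0 + c2 x * crd (gam t) 2 - c3 x * crd (gam t) 3).
    by apply/funext => t; rewrite /invariant_field !crdE; ring.
  by smooth_arith.
- have -> : (fun t => crd (invariant_field tau x (gam t)) 2) =
    (fun t => c1 x * tau^-1 * crd (gam t) 3 + c2 x * crd (gam t) 1 + c3 x * crd (gam t) 0).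
    by apply/funext => t; rewrite /invariant_field !crdE; ring.
  by smooth_arith.
- have -> : (fun t => crd (invariant_field tau x (gam t)) 3) =
    (fun t => - (c1 x * tau^-1) * crd (gam t) 2 + c2 x * crd (gam t) 0 - c3 x * crd (gam t) 1).
    by apply/funext => t; rewrite /invariant_field !crdE; ring.
  by smooth_arith.
Qed.

Lemma smooth_gmetric gam V x : tau != 0 -> smooth_vec4 gam -> smooth_vec4 V ->
  smooth_in J (fun t => gmetric tau (gam t) (V t) (invariant_field tau x (gam t))).
Proof.
move=> t0 hg hV; have hx := smooth_invariant_along x hg.
pose e : triple R := Triple (- tau) 0 0.
have X1E p : X1 p = invariant_field tau e p.
  by apply: vec4_eq; rewrite /invariant_field !crdE /=; field.
rewrite /gmetric; under eq_fun => t do rewrite X1E.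
have he := smooth_invariant_along e hg.
have ? := smooth_ip hV hx; have ? := smooth_ip hV he; have ? := smooth_ip hx he.
by smooth_arith.
Qed.

Lemma smooth_coef gam V : tau != 0 -> smooth_vec4 gam -> smooth_vec4 V ->
  smooth_triple (fun t => coef tau (gam t) (V t)).
Proof.
by move=> t0 hg hV; split; rewrite /coef/= ?E1E ?(E2E tau) ?(E3E tau);
  exact: smooth_gmetric.
Qed.

Lemma smooth_dtriple V : smooth_triple V -> smooth_triple (dtriple V).
Proof. by move=> [? ? ?]; split; exact: smooth_in_derive1. Qed.

Lemma smooth_taddr V Y : smooth_triple V -> smooth_triple Y ->
  smooth_triple (fun t => taddr (V t) (Y t)).
Proof. by move=> [? ? ?] [? ? ?]; split; rewrite /taddr/=; smooth_arith. Qed.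

Lemma smooth_conn V Y : smooth_triple V -> smooth_triple Y ->
  smooth_triple (fun t => conn tau (V t) (Y t)).
Proof. by move=> [? ? ?] [? ? ?]; split; rewrite /conn/=; smooth_arith. Qed.

(** The function form of covD, with T the coefficients of the velocity. *)
Definition cov (T V : R -> triple R) : R -> triple R :=
  fun t => taddr (dtriple V t) (conn tau (T t) (V t)).

Lemma smooth_cov T V : smooth_triple T -> smooth_triple V -> smooth_triple (cov T V).
Proof.
by move=> hT hV; apply: smooth_taddr; [exact: smooth_dtriple|exact: smooth_conn].
Qed.

Lemma covD_cov T V t : smooth_triple V -> J t -> covD tau (T t) V t (cov T V t).
Proof.
move=> [V1 V2 V3] Jt; split; rewrite /= addrK;
  apply: DeriveDef; rewrite -?derive1E//; exact: smooth_in_derivable Jt.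
Qed.

Lemma smooth_dot V Y : smooth_triple V -> smooth_triple Y ->
  smooth_in J (fun t => dot (V t) (Y t)).
Proof. by move=> [? ? ?] [? ? ?]; rewrite /dot; smooth_arith. Qed.

End TripleCurves.

(** * The interior of an interval *)

Section Interior.
Context {R : realType}.
Variable I : interval R.

(** The interior of I, in a form that avoids a case analysis on the kinds of end
    points. *)
Definition inner : set R := [set t | exists a b, [/\ a \in I, b \in I, a < t & t < b]].

Lemma inner_open : open inner.
Proof.
rewrite openE => t [a [b [aI bI ta tb]]].
have : \forall s \near t, s \in `]a, b[%R by apply: near_in_itvoo; rewrite in_itv/= ta.
by apply: filterS => s; rewrite in_itv/= => /andP[? ?]; exists a, b.
Qed.

Lemma inner_sub t : inner t -> t \in I.
Proof.
move=> [a [b [aI bI ta tb]]].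
have /(_ _ _ aI bI t) := @interval_is_interval R I.
by rewrite (ltW ta) (ltW tb); apply.
Qed.

Lemma inner_interval : is_interval inner.
Proof.
move=> x y [a [b [aI bI ax xb]]] [c [d [cI dI cy yd]]] z /andP[xz zy].
by exists a, d; split=> //; [exact: lt_le_trans xz|exact: le_lt_trans yd].
Qed.

Lemma inner_nonempty : nondegenerate_itv I -> exists t, inner t.
Proof.
move=> [a [b [aI bI ab]]]; exists ((a + b) / 2); exists a, b; split=> //; lra.
Qed.

(** A point of I is approached from within I on at least one side, since I has
    two points. *)
Lemma inner_dense f s : nondegenerate_itv I -> s \in I -> {for s, continuous f} ->
  (forall t, inner t -> f t = 0 :> R) -> f s = 0.
Proof.
move=> [a [b [aI bI ab]]] sI fs f0.
have [sb|bs] := ltP s b.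
  have fr : f t @[t --> s^'+] --> f s by apply: cvg_at_right_filter.
  have f0r : f t @[t --> s^'+] --> (0 : R).
    apply: cvg_near_cst; near=> t; apply: f0; exists s, b; split=> //.
  exact: (cvg_unique _ fr f0r).
have fl : f t @[t --> s^'-] --> f s by apply: cvg_at_left_filter.
have f0l : f t @[t --> s^'-] --> (0 : R).
  apply: cvg_near_cst; near=> t; apply: f0; exists a, s; split=> //.
  near: t; apply: nbhs_left_gt; exact: lt_le_trans ab bs.
exact: (cvg_unique _ fl f0l).
Unshelve. all: by end_near. Qed.

End Interior.

(** * Polar coordinates and angles *)

Section Angles.
Context {R : realType}.
Implicit Types x y r a : R.

Lemma polar x y r : 0 < r -> x ^+ 2 + y ^+ 2 = r ^+ 2 ->
  exists phi, x = r * sin phi /\ y = r * cos phi.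
Proof.
move=> r0 xyr; have r1 : r != 0 by rewrite gt_eqF.
have yr2 : (y / r) ^+ 2 <= 1.
  by rewrite expr_div_n ler_pdivrMr ?exprn_gt0// mul1r -xyr lerDr sqr_ge0.
have yr : -1 <= y / r <= 1.
  by rewrite -ler_norml -(@expr_le1 _ 2)// real_normK ?num_real.
have sphi : r * sin (acos (y / r)) = `|x|.
  rewrite sin_acos//; apply: (@pexpIrn _ 2) => //.
  - by rewrite nnegrE mulr_ge0 ?sqrtr_ge0// ltW.
  - rewrite exprMn sqr_sqrtr.
      rewrite real_normK ?num_real// mulrBr mulr1 -exprMn mulrC divfK//; lra.
    by rewrite subr_ge0.
have cphi : r * cos (acos (y / r)) = y by rewrite acosK ?in_itv// mulrC divfK.
have [x0|x0] := leP 0 x.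
  by exists (acos (y / r)); rewrite cphi sphi ger0_norm.
(* acos only reaches the half-plane where the sine is nonnegative *)
exists (- acos (y / r)); rewrite cosN sinN cphi mulrN sphi ltr0_norm//.
by rewrite opprK.
Qed.

Lemma acos_le_pihalf a : -1 <= a <= 1 -> (acos a <= pi / 2) = (0 <= a).
Proof.
move=> ha; have a1 : a \in `[-1, 1]%R by rewrite in_itv.
rewrite -{2}(acosK a1) -cos_pihalf leNgt -ltr_cos ?leNgt//.
- rewrite in_itv/=; have := @pi_ge0 R; lra.
- by rewrite in_itv/= acos_ge0// acos_lepi.
Qed.

Lemma smooth_on_affine (I : interval R) (k l : R) :
  smooth_on I (fun t => k * t + l : R^o).
Proof.
have cstP n (c t : R) : derivable (derive1n n (cst c : R -> R^o)) t 1.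
  elim: n c => [|n IH] c; first exact: derivable_cst.
  rewrite derive1Sn (_ : derive1 _ = cst 0) //.
  by apply/funext => u; rewrite derive1_cst.
have D (t : R) : is_derive t 1 (fun t : R => k * t + l) k.
  by apply: is_derive_eq; rewrite /GRing.scale/=; ring.
move=> s _; near=> t => -[|n]; first by have [] := D t.
have -> : derive1n n.+1 (fun t => k * t + l : R^o) = derive1n n (cst k).
  rewrite derive1Sn; congr (derive1n n _); apply/funext => u.
  by rewrite derive1E derive_val.
exact: cstP.
Unshelve. all: by end_near. Qed.

End Angles.

(** * Proper biharmonic curves *)

Section ProperBiharmonic.
Context {R : realType}.
Local Notation E4 := 'rV[R]_4.
Variables (tau : R) (htau : 0 < tau).
Variable nabla : (E4 -> E4) -> (E4 -> E4) -> E4 -> E4.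
Hypothesis hnabla : levi_civita tau nabla.
Variables (I : interval R) (hI : nondegenerate_itv I).
Variable gam : R -> E4.
Hypotheses (hgam : SL2_curve I gam) (harc : arc_length_parametrized tau I gam).

Let tau0 : tau != 0. Proof. by rewrite gt_eqF. Qed.

Let J : set R := interior [set t | forall n, derivable (derive1n n gam) t 1].

Let Jopen : open J. Proof. exact: open_interior. Qed.

Let IJ t : t \in I -> J t. Proof. exact: hgam.1. Qed.

Let O := inner I.

Let OI t : O t -> t \in I. Proof. exact: inner_sub. Qed.

Let OJ t : O t -> J t. Proof. by move/OI/IJ. Qed.

Let gamJ t : J t -> forall n, derivable (derive1n n gam) t 1.
Proof. exact: interior_subset. Qed.

Let derivable_gam t : J t -> derivable gam t 1.
Proof. by move=> Jt; exact: (@gamJ t Jt 0%N). Qed.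

Let smooth_gam : smooth_vec4 J gam.
Proof. by split; exact: smooth_in_crd. Qed.

Let smooth_velocity : smooth_vec4 J (velocity gam).
Proof.
have hv t : J t -> forall n, derivable (derive1n n (velocity gam)) t 1.
  by move=> Jt n; rewrite /velocity -derive1Sn; exact: gamJ.
by split; exact: (smooth_in_crd Jopen).
Qed.

Definition tangent_coef t := coef tau (gam t) (velocity gam t).
Local Notation T := tangent_coef.
Local Notation D := (cov tau T).

Let smooth_T : smooth_triple J T.
Proof. exact: smooth_coef. Qed.

Let smooth_DT : smooth_triple J (D T).
Proof. exact: smooth_cov. Qed.

Let smooth_DDT : smooth_triple J (D (D T)).
Proof. exact: smooth_cov. Qed.

(** In the interior this is the derivative of ip gam gam = 1; at the end points
    it follows by continuity. *)
Lemma ip_velocity t : t \in I -> ip (gam t) (velocity gam t) = 0.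
Proof.
move=> tI; apply: (inner_dense (f := fun t => ip (gam t) (velocity gam t)) hI tI).
  by apply: smooth_in_continuous (IJ tI); exact: smooth_ip.
move=> {tI}t Ot.
have gd k : is_derive t 1 (fun t => crd (gam t) k) (crd (velocity gam t) k).
  have /derivable_mxP gk := derivable_gam (OJ Ot).
  apply: DeriveDef; first exact: gk.
  by rewrite /velocity derive1E derive_mx ?/crd ?mxE//; exact: derivable_gam (OJ Ot).
have := is_derive_inj (@inner_open _ I) Ot
  (f := fun t => ip (gam t) (gam t)) (g := cst 1)
  (df := 2 * ip (gam t) (velocity gam t)) _ _ (is_derive_cst _ _ _).
move=> E; have : 2 * ip (gam t) (velocity gam t) = 0; last by lra.
apply: E; first by move=> s /OI; exact: hgam.2.
by rewrite /ip; apply: is_derive_eq; rewrite /GRing.scale/=; ring.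
Qed.

Lemma velocityE t : t \in I -> velocity gam t = invariant_field tau (T t) (gam t).
Proof. by move=> tI; rewrite invariant_coef ?ip_velocity//; exact: hgam.2. Qed.

Lemma dot_tangent t : t \in I -> dot (T t) (T t) = 1.
Proof.
move=> tI; rewrite -(harc tI) velocityE// gmetric_SL2//; exact: hgam.2.
Qed.

(** Iterating the covariant derivative requires the coefficients of V near t,
    hence the restriction to the interior. *)
Lemma covariant_derivative_coef (V : R -> E4) (Vc : R -> triple R) t :
  (forall s, O s -> coef tau (gam s) (V s) = Vc s) -> O t ->
  covariant_derivative tau nabla gam V t = invariant_field tau (D Vc t) (gam t).
Proof.
move=> VE Ot; rewrite (covariant_derivativeE hnabla)//; last exact: hgam.2 _ (OI Ot).
rewrite /cov (VE _ Ot).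
suff -> : dtriple (fun t => coef tau (gam t) (V t)) t = dtriple Vc t by [].
have der f g : (forall s, O s -> f s = g s :> R) -> derive1 f t = derive1 g t.
  by move=> fg; exact: derive1_eq_in (@inner_open _ I) _ _ fg _ Ot.
by rewrite /dtriple; congr Triple; apply: der => s Os; rewrite VE.
Qed.

Lemma coef_covariant_derivative (V : R -> E4) (Vc : R -> triple R) t :
  (forall s, O s -> coef tau (gam s) (V s) = Vc s) -> O t ->
  coef tau (gam t) (covariant_derivative tau nabla gam V t) = D Vc t.
Proof.
move=> VE Ot; rewrite (covariant_derivative_coef VE Ot) coef_invariant//.
exact: hgam.2 _ (OI Ot).
Qed.

Hypothesis hbih : proper_biharmonic tau nabla I gam.

Lemma biharmonic_coef t : O t -> D (D (D T)) t = curv tau (T t) (D T t) (T t).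
Proof.
move=> Ot; have hp : SL2 (gam t) := hgam.2 _ (OI Ot).
have E1 s : O s -> coef tau (gam s) (velocity gam s) = T s by [].
have E2 := fun s (Os : O s) => coef_covariant_derivative E1 Os.
have E3 := fun s (Os : O s) => coef_covariant_derivative E2 Os.
have := hbih.1 _ (OI Ot); rewrite /bitension.
rewrite (curvature_atE hnabla tau0 _ _ _ hp) (E2 _ Ot).
rewrite (covariant_derivative_coef E3 Ot) => /eqP; rewrite subr_eq0 => /eqP.
exact: invariant_field_inj.
Qed.

Let Oopen : open O := @inner_open _ I.

Let Oitv : is_interval O := @inner_interval _ I.

Let unitT t : O t -> dot (T t) (T t) = 1.
Proof. by move/OI; exact: dot_tangent. Qed.

Let DT t : O t -> covD tau (T t) T t (D T t).
Proof. by move/OJ; exact: covD_cov. Qed.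

Let DDT t : O t -> covD tau (T t) (D T) t (D (D T) t).
Proof. by move/OJ; exact: covD_cov. Qed.

Let DDDT t : O t -> covD tau (T t) (D (D T)) t (curv tau (T t) (D T t) (T t)).
Proof. by move=> Ot; rewrite -biharmonic_coef//; exact: covD_cov (OJ Ot). Qed.

(** |D_T T|^2 is constant in the interior; were it zero at one point, D_T T would
    vanish on all of I by continuity. *)
Lemma not_geodesic t : O t -> dot (D T t) (D T t) != 0.
Proof.
move=> Ot; apply/eqP => DT0; apply: hbih.2 => s sI.
have DT0' r : O r -> dot (D T r) (D T r) = 0.
  by rewrite -DT0; exact: (dot_WW tau0 Oopen Oitv Ot unitT DT DDT DDDT).
rewrite (covariant_derivativeE hnabla tau0); last exact: hgam.2.
rewrite -/(T s) -/(D T s) (_ : D T s = Triple 0 0 0).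
  by apply: vec4_eq; rewrite /invariant_field !crdE /=; ring.
apply: dot_eq0; apply: (inner_dense (f := fun s => dot (D T s) (D T s)) hI sI) => //.
by apply: smooth_in_continuous (IJ sI); exact: smooth_dot.
Qed.

Lemma eq_on_closure (f g : R -> R) : smooth_in J f -> smooth_in J g ->
  (forall t, O t -> f t = g t) -> forall s, s \in I -> f s = g s.
Proof.
move=> hf hg fg s sI; apply/eqP; rewrite -subr_eq0; apply/eqP.
apply: (inner_dense (f := fun t => f t - g t) hI sI) => [|t Ot].
  apply: smooth_in_continuous (IJ sI) => //.
  by apply: smooth_inD => //; exact: smooth_inN.
by rewrite fg// subrr.
Qed.

Lemma tangent_motion : exists a lam : R, [/\ a ^+ 2 < 1,
  (forall s, s \in I -> c1 (T s) = a) &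
  forall t, O t ->
    is_derive t 1 (fun s => c2 (T s)) (- lam * c3 (T t)) /\
    is_derive t 1 (fun s => c3 (T s)) (lam * c2 (T t))].
Proof.
have [t0 Ot0] := inner_nonempty hI.
have K0 := not_geodesic Ot0.
have [lam hlam] := horizontal_rotation tau0 Oopen Oitv Ot0 unitT DT DDT DDDT K0.
exists (c1 (T t0)), lam; split=> //.
  exact: (T1_lt1 tau0 Oopen Oitv Ot0 unitT DT DDT DDDT K0).
move=> s sI; apply: (eq_on_closure (f := fun s => c1 (T s))
  (g := cst (c1 (T t0))) _ _ _ sI).
- by have [] := smooth_T.
- exact: smooth_in_cst.
- exact: (T1_constant tau0 Oopen Oitv Ot0 unitT DT DDT DDDT K0).
Qed.

Lemma angle_E1 s : s \in I ->
  angle tau (gam s) (velocity gam s) (E1 tau (gam s)) = acos (c1 (T s)).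
Proof.
move=> sI; have hp := hgam.2 s sI.
have E11 : gmetric tau (gam s) (E1 tau (gam s)) (E1 tau (gam s)) = 1.
  by rewrite E1E gmetric_SL2// /dot/=; ring.
by rewrite /angle harc// E11 sqrtr1 mulr1 divr1.
Qed.

(** With beta s = - lam s + b, the scalar product F of (T2, T3) with
    (cos beta, - sin beta) and the scalar product G with (sin beta, cos beta) are
    first integrals of the rotation; b is chosen so that F = 0 and sigma G is the
    radius. *)
Lemma horizontal_polar (a lam sigma : R) : a ^+ 2 < 1 ->
  (forall s, s \in I -> c1 (T s) = a) ->
  (forall t, O t ->
    is_derive t 1 (fun s => c2 (T s)) (- lam * c3 (T t)) /\
    is_derive t 1 (fun s => c3 (T s)) (lam * c2 (T t))) ->
  sigma ^+ 2 = 1 ->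
  exists b, forall s, s \in I ->
    sigma * c2 (T s) = Num.sqrt (1 - a ^+ 2) * sin (- lam * s + b) /\
    sigma * c3 (T s) = Num.sqrt (1 - a ^+ 2) * cos (- lam * s + b).
Proof.
move=> a1 Ta TD s2; set r := Num.sqrt _.
have r0 : 0 < r by rewrite sqrtr_gt0 subr_gt0.
have [t0 Ot0] := inner_nonempty hI.
have Tr t : t \in I -> c2 (T t) ^+ 2 + c3 (T t) ^+ 2 = r ^+ 2.
  move=> tI; have := dot_tangent tI; rewrite /dot Ta// sqr_sqrtr ?subr_ge0 ?ltW//.
  lra.
have [phi [phi2 phi3]] : exists phi, sigma * c2 (T t0) = r * sin phi /\
    sigma * c3 (T t0) = r * cos phi.
  by apply: polar => //; rewrite !exprMn s2 !mul1r; exact/Tr/OI.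
pose b := phi + lam * t0; exists b.
pose beta (t : R) : R := - lam * t + b.
have Dbeta (t : R) : is_derive t 1 beta (- lam).
  by apply: is_derive_eq; rewrite /GRing.scale/=; ring.
have beta0 : beta t0 = phi by rewrite /beta /b; ring.
pose F t := c2 (T t) * cos (beta t) - c3 (T t) * sin (beta t).
pose G t := c2 (T t) * sin (beta t) + c3 (T t) * cos (beta t).
have FO t : O t -> F t = F t0.
  move=> Ot; apply: (is_derive0_constant (f := F) Oitv _ Ot Ot0) => u Ou.
  have [D2 D3] := TD u Ou; have Db := Dbeta u.
  by apply: is_derive_eq; rewrite /GRing.scale/=; ring.
have GO t : O t -> G t = G t0.
  move=> Ot; apply: (is_derive0_constant (f := G) Oitv _ Ot Ot0) => u Ou.
  have [D2 D3] := TD u Ou; have Db := Dbeta u.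
  by apply: is_derive_eq; rewrite /GRing.scale/=; ring.
have trig x : cos x ^+ 2 + sin x ^+ 2 = 1 := cos2Dsin2 x.
have F0 : sigma * F t0 = 0.
  have -> : sigma * F t0 = sigma * c2 (T t0) * cos (beta t0)
      - sigma * c3 (T t0) * sin (beta t0) by rewrite /F; ring.
  by rewrite phi2 phi3 beta0; ring.
have G0 : sigma * G t0 = r.
  have -> : sigma * G t0 = sigma * c2 (T t0) * sin (beta t0)
      + sigma * c3 (T t0) * cos (beta t0) by rewrite /G; ring.
  rewrite phi2 phi3 beta0; have -> : r * sin phi * sin phi + r * cos phi * cos phi
      = r * (cos phi ^+ 2 + sin phi ^+ 2) by ring.
  by rewrite trig mulr1.
have res t : O t -> sigma * c2 (T t) = r * sin (beta t) /\
    sigma * c3 (T t) = r * cos (beta t).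
  move=> Ot; split.
  - have -> : sigma * c2 (T t) =
        sigma * c2 (T t) * (cos (beta t) ^+ 2 + sin (beta t) ^+ 2).
      by rewrite trig mulr1.
    have -> : sigma * c2 (T t) * (cos (beta t) ^+ 2 + sin (beta t) ^+ 2) =
      (sigma * F t) * cos (beta t) + (sigma * G t) * sin (beta t).
      by rewrite /F /G; ring.
    by rewrite FO// GO// F0 G0 mul0r add0r.
  - have -> : sigma * c3 (T t) =
        sigma * c3 (T t) * (cos (beta t) ^+ 2 + sin (beta t) ^+ 2).
      by rewrite trig mulr1.
    have -> : sigma * c3 (T t) * (cos (beta t) ^+ 2 + sin (beta t) ^+ 2) =
      (sigma * G t) * cos (beta t) - (sigma * F t) * sin (beta t).
      by rewrite /F /G; ring.
    by rewrite FO// GO// F0 G0 mul0r subr0.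
have [_ sT2 sT3] := smooth_T.
have cbeta s : {for s, continuous beta}.
  by have [/derivable1_diffP/differentiable_continuous] := Dbeta s.
move=> s sI; split; apply/eqP; rewrite -subr_eq0; apply/eqP.
- apply: (inner_dense (f := fun t => sigma * c2 (T t) - r * sin (beta t)) hI sI); last first.
    by move=> t Ot; rewrite (res t Ot).1 subrr.
  apply: continuousB; apply: continuousM; try exact: cst_continuous.
    exact: smooth_in_continuous sT2 (IJ sI).
  by apply: continuous_comp; [exact: cbeta|exact: continuous_sin].
- apply: (inner_dense (f := fun t => sigma * c3 (T t) - r * cos (beta t)) hI sI); last first.
    by move=> t Ot; rewrite (res t Ot).2 subrr.
  apply: continuousB; apply: continuousM; try exact: cst_continuous.
    exact: smooth_in_continuous sT3 (IJ sI).
  by apply: continuous_comp; [exact: cbeta|exact: continuous_cos].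
Qed.

End ProperBiharmonic.

(* The factor sigma is an orientation of the curve: reversing the parameter of a
   proper biharmonic curve gives a proper biharmonic curve and changes the sign
   of the E1-component of T, so that the angle can be taken in (0, pi/2] only
   after possibly reversing the orientation.  When T makes an angle at most pi/2
   with E1, no reversal is needed (sigma = 1). *)
Theorem proposition3p3 (R : realType) (tau : R) (htau : 0 < tau)
  (nabla : ('rV[R]_4 -> 'rV[R]_4) -> ('rV[R]_4 -> 'rV[R]_4) ->
           'rV[R]_4 -> 'rV[R]_4)
  (hnabla : levi_civita tau nabla)
  (I : interval R) (hI : nondegenerate_itv I)
  (gam : R -> 'rV[R]_4)
  (hgam : SL2_curve I gam)
  (harc : arc_length_parametrized tau I gam)
  (hbih : proper_biharmonic tau nabla I gam) :
  (exists alpha : R, forall s : R, s \in I ->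
     angle tau (gam s) (velocity gam s) (E1 tau (gam s)) = alpha) /\
  (exists (sigma theta : R) (beta : R -> R),
     [/\ sigma = 1 \/ sigma = -1,
         (forall s : R, s \in I ->
            angle tau (gam s) (velocity gam s) (E1 tau (gam s)) <= pi / 2) ->
           sigma = 1,
         0 < theta <= pi / 2,
         smooth_on I beta &
         forall s : R, s \in I ->
           sigma *: velocity gam s =
             cos theta *: E1 tau (gam s)
             + (sin theta * sin (beta s)) *: E2 (gam s)
             + (sin theta * cos (beta s)) *: E3 (gam s)]).
Proof.
have [a [lam [a1 Ta TD]]] := tangent_motion htau hnabla hI hgam harc hbih.
have angleE s : s \in I ->
    angle tau (gam s) (velocity gam s) (E1 tau (gam s)) = acos a.
  by move=> sI; rewrite (angle_E1 htau hgam harc sI) Ta.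
split; first by exists (acos a).
(* The orientation making the E1-component of sigma T nonnegative. *)
pose sigma : R := if 0 <= a then 1 else -1.
have sigma_a : sigma * a = `|a|.
  rewrite /sigma; case: ifPn => [a0|]; first by rewrite mul1r ger0_norm.
  by rewrite -ltNge => a0; rewrite mulN1r ltr0_norm.
have sigma2 : sigma ^+ 2 = 1 by rewrite /sigma; case: ifP; rewrite ?sqrrN expr1n.
have na : `|a| < 1 by rewrite -(@expr_lt1 _ 2)// real_normK ?num_real.
have na1 : -1 <= `|a| <= 1.
  by rewrite (ltW na) (le_trans (lerN10 _) (normr_ge0 a)).
have [b hb] := horizontal_polar htau hI hgam harc a1 Ta TD sigma2.
exists sigma, (acos `|a|), (fun s => - lam * s + b); split.
- by rewrite /sigma; case: ifP; [left|right].
- move=> hangle; have [s [p [q [pI qI ps sq]]]] := inner_nonempty hI.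
  move: (hangle p pI); rewrite angleE// acos_le_pihalf; first by rewrite /sigma => ->.
  by rewrite -ler_norml ltW.
- rewrite acos_le_pihalf// normr_ge0 andbT acos_gt0// na andbT.
  by case/andP: na1.
- exact: smooth_on_affine.
- move=> s sI; have [hb2 hb3] := hb s sI.
  rewrite acosK ?in_itv// sin_acos// real_normK ?num_real// -hb2 -hb3.
  rewrite (velocityE htau hI hgam sI) /invariant_field Ta// -sigma_a.
  by rewrite !scalerDr !scalerA.
Qed.
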